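(* Suppose $\varphi(\cdot)=-\log(\cdot)$ and $\mathbf{V}^\top\in\mathbb{R}^{d\times d}$ is invertible. Define $$f_{\Gamma\text{-g}}(\mathbf{x},\boldsymbol{\rho})=G_s\big(\mathbf{V}\,\mathrm{Diag}(\exp(\boldsymbol{\rho}))\,\mathrm{Diag}(\mathbf{x})\,\mathbf{V}^\top\big)+\sum_{i=1}^d x_i\rho_i .$$ For any fixed $\boldsymbol{\rho}\in\mathbb{R}^d$, the function $f_{\Gamma\text{-g}}(\mathbf{x},\boldsymbol{\rho})$ is convex in $\mathbf{x}\in\mathbb{R}^d$ (as an extended-real-valued function), and for any fixed $\mathbf{x}\in\mathcal{X}$, the function $f_{\Gamma\text{-g}}(\mathbf{x},\boldsymbol{\rho})$ is concave in $\boldsymbol{\rho}\in\mathbb{R}^d$.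
   Context: $\mathcal{X}=\{\mathbf{x}\in[0,1]^d:\ \mathbf{1}^\top\mathbf{x}=s,\ \mathbf{A}\mathbf{x}\le\mathbf{b}\}$ for a given integer $1\le s\le d$, matrix $\mathbf{A}$ and vector $\mathbf{b}$. $\mathbb{S}^d$ is the space of real symmetric $d\times d$ matrices; $\boldsymbol{\lambda}(\mathbf{X})$ is the vector of eigenvalues of $\mathbf{X}\in\mathbb{S}^d$ in nonincreasing order; $\mathrm{Diag}(\mathbf{x})$ is the diagonal matrix with diagonal $\mathbf{x}$; $\exp$ is applied componentwise. $\mathbb{K}_{o,d}=\{\mathbf{x}\in\mathbb{R}^d: x_1\ge\dots\ge x_d\}$. $\mathbf{u}\succcurlyeq_m\mathbf{w}$ ($\mathbf{u}$ majorizes $\mathbf{w}$) means $\sum_i u_i=\sum_i w_i$ and for each $j\le d-1$ the sum of the $j$ largest entries of $\mathbf{u}$ is at least that of $\mathbf{w}$. With $\varphi=-\log$ (and $-\log t=+\infty$ for $t\le0$), $G_s(\mathbf{X})=g_s(\boldsymbol{\lambda}(\mathbf{X}))$ where $$g_s(\boldsymbol{\lambda})=\min_{\boldsymbol{\xi}\in\mathbb{R}^d_+}\Big\{-\sum_{i=1}^s\log\xi_i:\ \boldsymbol{\xi}\succcurlyeq_m\boldsymbol{\lambda},\ \boldsymbol{\xi}\in\mathbb{K}_{o,d}\Big\}$$ (the minimum over the empty set being $+\infty$); $G_s$ is finite exactly on positive semidefinite matrices of rank at least $s$. *)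

(* Defs.v *)
From HB Require Import structures.
From mathcomp Require Import all_boot all_order all_algebra.
From mathcomp Require Import sesquilinear spectral.
From mathcomp Require Import all_classical all_reals all_analysis.
From mathcomp Require Import complex.

Set Implicit Arguments.
Unset Strict Implicit.
Unset Printing Implicit Defensive.

Import Order.TTheory GRing.Theory Num.Theory.
Local Open Scope classical_set_scope.
Local Open Scope ring_scope.

Definition feasible (R : realType) (d m s : nat)
    (A : 'M[R]_(m, d)) (b : 'cV[R]_m) : set 'cV[R]_d :=
  [set x : 'cV[R]_d |
     [/\ forall i, 0 <= x i 0 <= 1,
         \sum_i x i 0 = s%:R
       & forall k, (A *m x) k 0 <= b k 0]].

Definition Kod (R : realType) (d : nat) : set 'cV[R]_d :=
  [set x : 'cV[R]_d | forall i j : 'I_d, (i <= j)%N -> x j 0 <= x i 0].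

Definition sum_largest (R : realType) (d : nat) (j : nat) (x : 'cV[R]_d) : R :=
  \sum_(y <- take j (sort >=%R [seq x i 0 | i <- enum 'I_d])) y.

Definition majorizes (R : realType) (d : nat) (u w : 'cV[R]_d) : Prop :=
  \sum_i u i 0 = \sum_i w i 0 /\
  forall j : nat, (j <= d.-1)%N -> sum_largest j w <= sum_largest j u.

(* The default value 0 is only reached when the characteristic polynomial does
   not split over R, hence never for a symmetric X: see [eigvalsP]. *)
Definition eigvals (R : realType) (d : nat) (X : 'M[R]_d) : 'cV[R]_d :=
  xget 0 [set l : 'cV[R]_d | Kod l /\ char_poly X = \prod_i ('X - (l i 0)%:P)].

Lemma eigvalsP (R : realType) (d : nat) (X : 'M[R]_d) : X^T = X ->
  Kod (eigvals X) /\ char_poly X = \prod_i ('X - (eigvals X i 0)%:P).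
Proof.
move=> XT; rewrite /eigvals; case: xgetP => [l _ //|].
pose Y : 'M[R[i]]_d := map_mx (real_complex R) X.
have Yh : Y \is hermsymmx.
  apply: realsym_hermsym.
    apply/is_hermitianmxP; rewrite expr0 scale1r.
    by apply/matrixP => i j; rewrite !mxE -[in LHS]XT mxE.
  by apply/mxOverP => i j; rewrite mxE; rewrite complex_real.
have /mxOverP Dr := hermitian_spectral_diag_real Yh.
have /orthomx_spectralP Ye := hermitian_normalmx Yh.
set D := spectral_diag Y in Dr Ye.
pose t := sort >=%R [seq complex.Re (D 0 i) | i <- enum 'I_d].
have tsz : size t = d by rewrite size_sort size_map size_enum_ord.
move=> /(_ (\col_i t`_i))[]; split.
  move=> i j ij; rewrite !mxE.
  apply: (sorted_leq_nth (@ge_trans _ _) (@ge_refl _ _)) => //.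
  - by apply: sort_sorted => u v; exact: le_total.
  - by rewrite inE tsz.
  - by rewrite inE tsz.
apply: (map_poly_inj (real_complex R)); rewrite map_char_poly -/Y.
have -> : char_poly Y = char_poly (diag_mx D).
  set P := spectralmx Y in Ye.
  have Pu : P \in unitmx by exact: spectral_unit.
  have CE : char_poly_mx Y = map_mx polyC (invmx P) *m
      char_poly_mx (diag_mx D) *m map_mx polyC P.
    rewrite /char_poly_mx mulmxBr mulmxBl -!map_mxM -Ye; congr (_ - _).
    by rewrite scalar_mxC -mulmxA -map_mxM mulVmx// map_mx1 mulmx1.
  rewrite /char_poly CE !det_mulmx mulrC mulrA -det_mulmx -map_mxM.
  by rewrite mulmxV// map_mx1 det1 mul1r.
rewrite char_poly_trig ?diag_mx_is_trig// rmorph_prod/=.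
under [RHS]eq_bigr do rewrite rmorphB/= map_polyX map_polyC/= mxE.
under [LHS]eq_bigr => i _ do
  rewrite mxE eqxx mulr1n -(RRe_real (Dr 0 i)).
rewrite -(big_mkord xpredT (fun i => 'X - (real_complex R t`_i)%:P)) -[X in index_iota 0 X]tsz.
rewrite -(big_nth 0 xpredT (fun y => 'X - (real_complex R y)%:P)).
have pt : perm_eq t [seq complex.Re (D 0 i) | i <- enum 'I_d].
  by rewrite perm_sort.
by rewrite (perm_big _ pt) big_map big_enum.
Qed.

(* [lne] is -oo on nonpositive reals, so that [- lne t%:E] is the extended -log.
   The infimum is +oo when no xi is admissible; otherwise the admissible set is
   compact and the objective lower semicontinuous, so it is a minimum. *)
Definition gs (R : realType) (d s : nat) (l : 'cV[R]_d) : \bar R :=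
  ereal_inf [set (\sum_(i < d | (i < s)%N) - lne (xi i 0)%:E)%E | xi in
    [set xi : 'cV[R]_d |
      [/\ forall i, 0 <= xi i 0, majorizes xi l & Kod xi]]].

Definition Gs (R : realType) (d s : nat) (X : 'M[R]_d) : \bar R :=
  gs s (eigvals X).

Definition Diag (R : realType) (d : nat) (x : 'cV[R]_d) : 'M[R]_d :=
  diag_mx x^T.

Definition f_Gamma_g (R : realType) (d s : nat) (V : 'M[R]_d)
    (x rho : 'cV[R]_d) : \bar R :=
  (Gs s (V *m Diag (map_mx expR rho) *m Diag x *m V^T)
   + (\sum_i x i 0 * rho i 0)%:E)%E.

(* Convexity and concavity of extended-real-valued functions are convexity of
   the epigraph, resp. of the hypograph: no indeterminate sum is involved. *)
Definition convex_ereal (R : realType) (E : lmodType R) (f : E -> \bar R) :=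
  convex_set ([set p | (f p.1 <= (p.2 : R)%:E)%E] : set (E * R^o)%type).

Definition concave_ereal (R : realType) (E : lmodType R) (f : E -> \bar R) :=
  convex_set ([set p | ((p.2 : R)%:E <= f p.1)%E] : set (E * R^o)%type).

(* Main.v *)
Require Import Defs.
From mathcomp Require Import all_boot all_order all_algebra all_fingroup.
From mathcomp Require Import sesquilinear spectral.
From mathcomp Require Import all_classical all_reals all_analysis.
From mathcomp Require Import complex ring lra.

(** For a sorted nonnegative vector [l] the value [gs s l] is minus the maximum of the
    entropy expression [\sum_i q_i ln (l_i / q_i)] over the weight vectors [q] with
    [0 <= q_i <= 1] and [\sum_i q_i = s] that vanish where [l] does
    ([gs_level_dual]).  Both the minimizer [xi] and the maximizer [q] are explicit
    in terms of the level [c] with [\sum_i min (l_i) c = s c]: the first [s] entries of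
    [xi] are [max (l_i) c] and the others are 0, while [q_i = min 1 (l_i / c)].  Outside
    the nonnegative vectors with at least [s] positive entries, [gs] is +oo
    ([gs_fin]).

    This formula gives both halves of the theorem, because the expression is concave
    in [l] jointly with [q], and linear in [ln l] for fixed [q].

    Convexity in [x].  The matrix is linear in [x], so it is enough that [Gs] be convex
    ([Gs_convex]).  In an eigenbasis of [a X1 + b X2], the eigenvalues of this matrix
    are combinations of diagonals of [X1] and [X2], that is, of doubly stochastic
    images of their eigenvalues ([pinching]).  The log-sum inequality ([log_sum]) then
    transports optimal weights of [X1] and [X2] to weights of the combination.

    Concavity in [rho].  Let [Y r] be the matrix with weights [exp (r_i) x_i].  The product of its
    [k] largest eigenvalues is the maximum, over [k]-dimensional subspaces, of the
    determinant of the compression of [Y r]; by Cauchy-Binet this determinant is a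
    nonnegative combination of exponentials of linear forms in [r], so its logarithm
    is convex in [r], and so is the logarithm of the product
    ([top_eigvals_log_convex]).  The optimal weights at the middle of a segment are
    nonincreasing, so summation by parts ([abel_sum_ge0]) turns these convexity
    inequalities for partial sums into the one for the entropy expression.  Keeping
    the same weights at the two ends of the segment bounds the value there from
    above, which is the direction needed for concavity. *)

Set Implicit Arguments.
Unset Strict Implicit.
Unset Printing Implicit Defensive.

Import Order.TTheory GRing.Theory Num.Theory.
Local Open Scope classical_set_scope.
Local Open Scope ring_scope.
Local Open Scope sesquilinear_scope.

(** * Log-sum inequality and summation by parts *)

(** The perspective of the logarithm.  With [b / 0 = 0] and [ln 0 = 0], it takes
    its limit value 0 at [a = 0]; it is only used where [0 < a] forces [0 < b],
    since at [b = 0 < a] the limit would be -oo and the formula gives 0. *)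
Definition persp (R : realType) (a b : R) : R := a * ln (b / a).

(** The perspective is concave and homogeneous, so it lies below its tangent at
    [(A, B)]; concretely this is [ln z <= z - 1] at [z = b A / (a B)]. *)
Lemma persp_tangent (R : realType) (a b A B : R) :
  0 <= a -> 0 <= b -> (0 < a -> 0 < b) -> 0 < A -> 0 < B ->
  persp a b <= a * ln (B / A) + (b * A / B - a).
Proof.
move=> a0 b0 ab A0 B0; rewrite /persp.
have [->|an0] := eqVneq a 0.
  by rewrite !mul0r add0r subr0 divr_ge0 ?mulr_ge0 // ltW.
have {an0 a0}a0 : 0 < a by rewrite lt_def an0.
have {b0 ab}b0 := ab a0.
have z0 : 0 < b * A / (a * B) by rewrite divr_gt0 ?mulr_gt0.
have E : ln (b / a) = ln (B / A) + ln (b * A / (a * B)).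
  rewrite -lnM ?posrE ?divr_gt0 ?mulr_gt0 //; congr ln; field.
  by rewrite !gt_eqF.
have L : ln (b * A / (a * B)) <= b * A / (a * B) - 1.
  have := @le_ln1Dx R (b * A / (a * B) - 1); rewrite [1 + _]addrC subrK; apply.
  by rewrite ltrBrDr addNr.
rewrite E mulrDr lerD2l.
apply: (le_trans (ler_wpM2l (ltW a0) L)).
rewrite le_eqVlt; apply/orP; left; apply/eqP; field.
by rewrite !gt_eqF.
Qed.

(** Joint concavity and homogeneity of the perspective: sum the tangent
    inequalities taken at the point [(\sum_i w i * a i, \sum_i w i * b i)], where
    the affine corrections cancel. *)
Lemma log_sum (R : realType) (I : finType) (w a b : I -> R) :
  (forall i, 0 <= w i) -> (forall i, 0 <= a i) -> (forall i, 0 <= b i) ->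
  (forall i, 0 < w i -> 0 < a i -> 0 < b i) ->
  \sum_i w i * persp (a i) (b i) <= persp (\sum_i w i * a i) (\sum_i w i * b i).
Proof.
move=> w0 a0 b0 ab; set A := \sum_i w i * a i; set B := \sum_i w i * b i.
have wa0 i : 0 <= w i * a i by rewrite mulr_ge0.
have wb0 i : 0 <= w i * b i by rewrite mulr_ge0.
have [A0|An0] := eqVneq A 0.
  rewrite A0 /persp mul0r big1 // => i _.
  by rewrite mulrA (psumr_eq0P _ A0) ?mul0r.
have A0 : 0 < A by rewrite lt_def An0 sumr_ge0.
have B0 : 0 < B.
  have [i _ wai] : exists2 i, true & 0 < w i * a i.
    apply/exists2P; apply: contrapT => /forallNP H.
    move/eqP: An0; apply; apply: big1 => i _.
    by apply/eqP; apply/negP => /negP n0; apply: (H i); split=> //; rewrite lt_def n0 wa0.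
  have wi : 0 < w i by rewrite lt_def w0 andbT; apply: contraTneq wai => ->; rewrite mul0r ltxx.
  have ai : 0 < a i by rewrite -(pmulr_rgt0 _ wi).
  rewrite /B (bigD1 i) //=; apply: ltr_wpDr; first by rewrite sumr_ge0.
  by rewrite mulr_gt0 // ab.
have -> : persp A B = \sum_i w i * (a i * ln (B / A) + (b i * A / B - a i)).
  transitivity (A * ln (B / A) + (B * A / B - A)).
    by rewrite /persp; field; rewrite !gt_eqF.
  rewrite {1 4 5}/A {1}/B !mulr_suml -sumrB -big_split /=.
  by apply: eq_bigr => i _; ring.
apply: ler_sum => i _; have [->|wn0] := eqVneq (w i) 0; first by rewrite !mul0r.
have wi : 0 < w i by rewrite lt_def wn0 w0.
by rewrite ler_wpM2l // persp_tangent // => /ab; apply.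
Qed.

(** Summation by parts.  The partial sums of [t] only need to be nonnegative up to
    the last positive weight, which is what lets the logarithms of vanishing
    eigenvalues be ignored later on. *)
Lemma abel_sum_nat_ge0 (R : realType) (q t : nat -> R) (n : nat) :
  (forall i, (i.+1 < n)%N -> q i.+1 <= q i) -> (forall i, (i < n)%N -> 0 <= q i) ->
  (forall j, (j < n)%N -> 0 < q j -> 0 <= \sum_(i < j.+1) t i) ->
  0 <= \sum_(i < n) q i * t i.
Proof.
case: n => [|n] qd q0 tp; first by rewrite big_ord0.
(* Induction needs the boundary term of the summation by parts. *)
have key m : (m <= n)%N -> q m * \sum_(i < m.+1) t i <= \sum_(i < m.+1) q i * t i.
  elim: m => [|m IH] mn; first by rewrite !big_ord1.
  rewrite big_ord_recr [leRHS]big_ord_recr /= mulrDr lerD2r.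
  apply: le_trans (IH (ltnW mn)).
  have [qm|qm] := eqVneq (q m) 0.
    have -> : q m.+1 = 0 by apply/le_anti; rewrite q0 // -{1}qm qd.
    by rewrite qm.
  by rewrite ler_wpM2r ?qd // tp ?lt_def ?qm ?q0 // ltnS ltnW.
apply: le_trans (key n (leqnn n)).
have [->|qn] := eqVneq (q n) 0; first by rewrite mul0r.
by rewrite mulr_ge0 ?q0 // tp // lt_def qn q0.
Qed.

Lemma abel_sum_ge0 (R : realType) (d : nat) (q t : 'I_d -> R) :
  (forall i j : 'I_d, (i <= j)%N -> q j <= q i) -> (forall i, 0 <= q i) ->
  (forall j : 'I_d, 0 < q j -> 0 <= \sum_(i < d | (i <= j)%N) t i) ->
  0 <= \sum_i q i * t i.
Proof.
move=> qd q0 tp.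
pose ext (f : 'I_d -> R) k := if insub k is Some i then f i else 0.
have extE f (i : 'I_d) : ext f i = f i by rewrite /ext valK.
under eq_bigr do rewrite -(extE q) -(extE t).
apply: (@abel_sum_nat_ge0 R (ext q) (ext t)).
- move=> i id; rewrite (extE q (Ordinal id)) (extE q (Ordinal (ltnW id))).
  exact: qd.
- by move=> i id; rewrite (extE q (Ordinal id)).
move=> j jd; rewrite (extE q (Ordinal jd)) => /tp; congr (_ <= _).
rewrite (big_ord_widen d (ext t)) //=.
by apply: eq_big => [i|i _]; rewrite ?ltnS ?extE.
Qed.

(** * Majorization of sorted vectors *)

Lemma sum_take (R : realType) (t : seq R) (j : nat) :
  \sum_(y <- take j t) y = \sum_(0 <= k < size t | (k < j)%N) t`_k.
Proof.
elim: t j => [j|x t IH [|j]] /=.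
- by rewrite big_nil big_geq.
- by rewrite big_nil big1.
by rewrite big_cons IH [RHS]big_mkcond [RHS]big_nat_recl //= -big_mkcond.
Qed.

(** Turns the sorting in the definition of majorization into plain partial sums. *)
Lemma sum_largest_Kod (R : realType) (d j : nat) (x : 'cV[R]_d) : Kod x ->
  sum_largest j x = \sum_(i < d | (i < j)%N) x i 0.
Proof.
move=> Kx; rewrite /sum_largest.
have st : sorted >=%R [seq x i 0 | i <- enum 'I_d].
  rewrite sorted_map; apply/(sub_sorted (e := fun i k : 'I_d => (i <= k)%N)).
    by move=> i k /Kx.
  by have := iota_sorted 0 d; rewrite -val_enum_ord sorted_map.
rewrite (sorted_sort (@ge_trans _ R) st) sum_take size_map size_enum_ord big_mkord.
apply: eq_bigr => i _; rewrite (nth_map i) ?size_enum_ord //.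
by rewrite nth_ord_enum.
Qed.

Lemma majorizes_sum (R : realType) (d j : nat) (u l : 'cV[R]_d) :
  Kod u -> Kod l -> majorizes u l ->
  \sum_(i < d | (i < j)%N) l i 0 <= \sum_(i < d | (i < j)%N) u i 0.
Proof.
move=> Ku Kl [E M]; have [jd|dj] := leqP j d.-1.
  by rewrite -!sum_largest_Kod // M.
have dj' (i : 'I_d) : (i < j)%N by apply: leq_trans dj; case: d i {E M Ku Kl u l} => [[]|d i].
by rewrite (eq_bigl _ _ dj') [leRHS](eq_bigl _ _ dj') E.
Qed.

(** * Entropy formula for the optimal value *)

(** The weights [q] range over the hypersimplex; the support condition excludes
    the terms [q_i ln (0 / q_i)], which should be -oo. *)
Definition admissible (R : realType) (d s : nat) (q : 'I_d -> R) (l : 'cV[R]_d) :=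
  [/\ forall i, 0 <= q i <= 1, \sum_i q i = s%:R & forall i, 0 < q i -> 0 < l i 0].

(** Minus the relative entropy of [q] with respect to [l]. *)
Definition neg_relent (R : realType) (d : nat) (q : 'I_d -> R) (l : 'cV[R]_d) : R :=
  \sum_i persp (q i) (l i 0).

(** The water level of [l].  Let [c k] be the sum of the tail [l_k, l_(k+1), ...]
    divided by [s - k].  The least [k < s] whose level dominates its own tail works:
    if [k > 0], minimality says that the level at [k - 1] fails, which rearranges to
    [c k < l_(k-1)], so the entries before [k] lie above the level. *)
Lemma level_exists (R : realType) (d s : nat) (l : 'cV[R]_d) :
  (0 < s <= d)%N -> Kod l -> (forall i, 0 <= l i 0) ->
  (forall i : 'I_d, (i < s)%N -> 0 < l i 0) ->
  exists c, [/\ 0 < c, \sum_i Num.min (l i 0) c = s%:R * c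
     & forall i : 'I_d, (s <= i)%N -> l i 0 <= c].
Proof.
move=> /andP[s0 sd] Kl l0 lp.
pose S k := \sum_(i < d | (k <= i)%N) l i 0.
pose c k := S k / (s - k)%:R.
pose P k := (k < s)%N && [forall i : 'I_d, (k <= i)%N ==> (l i 0 <= c k)].
have Ssplit (i : 'I_d) : S i = l i 0 + S i.+1.
  rewrite /S (bigD1 i) //=; congr (_ + _); apply: eq_bigl => k.
  by rewrite ltn_neqAle andbC eq_sym.
have S0 k : 0 <= S k by rewrite sumr_ge0.
have exP : exists k, P k.
  exists s.-1; rewrite /P prednK // leqnn; apply/forallP => i; apply/implyP => si.
  have sd' : (s.-1 < d)%N by rewrite prednK.
  have -> : c s.-1 = S s.-1 by rewrite /c (_ : (s - s.-1)%N = 1) ?divr1 // -{1}(prednK s0) subSnn.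
  apply: (le_trans (Kl (Ordinal sd') i si)).
  by rewrite [leRHS](Ssplit (Ordinal sd')) lerDl.
case: (ex_minnP exP) => k /andP[ks /forallP Pk] kmin.
have skp : 0 < (s - k)%:R :> R by rewrite ltr0n subn_gt0.
have kd : (k < d)%N by apply: leq_trans ks sd.
have c0 : 0 < c k.
  by apply: lt_le_trans (lp (Ordinal kd) ks) _; exact: (implyP (Pk (Ordinal kd))).
have low (i : 'I_d) : (i < k)%N -> c k < l i 0.
  case: k kmin ks {Pk} skp kd c0 => // k kmin ks skp kd c0 ik.
  have : ~~ P k by apply/negP => /kmin; rewrite ltnn.
  rewrite negb_and (ltnW ks) /= => /forallPn[j]; rewrite negb_imply -ltNge => /andP[kj cj].
  have kd' := ltnW kd.
  apply: lt_le_trans (Kl i (Ordinal kd') ik).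
  have {cj} : c k < l (Ordinal kd') 0 by apply: lt_le_trans cj (Kl _ _ _).
  rewrite /c (Ssplit (Ordinal kd')) /= !ltr_pdivrMr ?ltr0n ?subn_gt0 //; last exact: ltnW.
  have -> : (s - k)%N = (s - k.+1).+1 by rewrite subnSK // ltnW.
  by rewrite -natr1 mulrDr mulr1 addrC ltrD2r.
have high (i : 'I_d) : (k <= i)%N -> l i 0 <= c k by move=> ki; exact: (implyP (Pk i)).
exists (c k); split => //; last by move=> i si; apply: high; rewrite ltnW // (leq_trans ks).
rewrite (bigID (fun i : 'I_d => (i < k)%N)) /=.
have -> : \sum_(i < d | (i < k)%N) Num.min (l i 0) (c k) = k%:R * c k.
  rewrite (eq_bigr (fun=> c k)); last by move=> i ik; rewrite min_r // ltW // low.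
  rewrite -(big_ord_widen d (fun=> c k)) ?(ltnW kd) //.
  by rewrite sumr_const card_ord mulr_natl.
rewrite (eq_bigr (fun i => l i 0)); last first.
  by move=> i; rewrite -leqNgt => /high ?; rewrite min_l.
rewrite (eq_bigl (fun i : 'I_d => (k <= i)%N)); last by move=> i; rewrite -leqNgt.
rewrite -/(S k) -[s in RHS](subnKC (ltnW ks)) natrD mulrDl; congr (_ + _).
by rewrite /c mulrCA divff ?mulr1 // gt_eqF.
Qed.

Lemma sum_indicator (R : realType) (d s : nat) (c : R) : (s <= d)%N ->
  \sum_(i < d) (if (i < s)%N then c else 0) = s%:R * c.
Proof.
move=> sd; rewrite -big_mkcond -(big_ord_widen d (fun=> c)) //=.
by rewrite sumr_const card_ord mulr_natl.
Qed.

(** The tangent line to -log, valid at [x = 0] too because the right side is then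
    +oo; no case distinction on vanishing coordinates is needed later. *)
Lemma neg_lne_tangent (R : realType) (x eta : R) : 0 <= x -> 0 < eta ->
  ((- ln eta - (x / eta - 1))%:E <= - lne x%:E)%E.
Proof.
move=> x0 e0; have [->|xn0] := eqVneq x 0; first by rewrite le0_lneNy ?leey.
have xp : 0 < x by rewrite lt_def xn0.
rewrite lne_EFin // -EFinN lee_fin.
have := @persp_tangent R 1 x 1 eta ler01 x0 (fun=> xp) ltr01 e0.
rewrite /persp !mul1r !divr1 mulr1; lra.
Qed.

Section WaterLevel.
Variables (R : realType) (d s : nat) (l : 'cV[R]_d) (c : R).
Hypotheses (sd : (s <= d)%N) (Kl : Kod l) (l0 : forall i, 0 <= l i 0).
Hypotheses (c0 : 0 < c) (cE : \sum_i Num.min (l i 0) c = s%:R * c).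
Hypothesis lc : forall i : 'I_d, (s <= i)%N -> l i 0 <= c.

Let raised (i : 'I_d) := Num.max (l i 0) c.
Let opt := \sum_(i < d | (i < s)%N) ln (raised i).

Lemma raised_gt0 i : 0 < raised i. Proof. by rewrite lt_max c0 orbT. Qed.

Lemma sum_div_raised : \sum_i l i 0 / raised i = s%:R.
Proof.
have cn0 : c != 0 by rewrite gt_eqF.
apply: (mulIf cn0); rewrite -cE mulr_suml.
apply: eq_bigr => i _; rewrite /raised.
by have [h|h] := leP (l i 0) c; [rewrite divfK ?gt_eqF|rewrite divff ?mul1r // gt_eqF // (lt_trans c0)].
Qed.

Lemma ln_raised i : ln c <= ln (raised i).
Proof. by rewrite ler_ln ?posrE ?raised_gt0 // le_max lexx orbT. Qed.

Lemma ln_raised_low (i : 'I_d) : l i 0 <= c -> ln (raised i) = ln c.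
Proof. by rewrite /raised => h; rewrite max_r. Qed.

(** Both weightings have total weight [s], so [ln c] may be subtracted from every
    logarithm; what remains vanishes wherever [l i 0 <= c]. *)
Lemma weighted_ln_raised (q : 'I_d -> R) : \sum_i q i = s%:R ->
  \sum_i q i * ln (raised i) - opt
  = \sum_i (q i - (if (i < s)%N then 1 else 0)) * (ln (raised i) - ln c).
Proof.
move=> qs; transitivity (\sum_i q i * ln (raised i) - opt
    - (\sum_i q i - \sum_(i < d) (if (i < s)%N then 1 else 0)) * ln c).
  by rewrite qs sum_indicator // mulr1 subrr mul0r subr0.
rewrite mulrBl !mulr_suml /opt [X in _ - X - _]big_mkcond /= -!sumrB; apply: eq_bigr => i _.
by case: ifP => _; ring.
Qed.

(** Apply the tangent inequality at [(1, max (l_i) c)]: the affine terms cancel since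
    [\sum_i l_i / max (l_i) c = s], and moving the weight to the first [s] indices
    only increases [\sum_i q_i ln (max (l_i) c)]. *)
Lemma neg_relent_le_opt q : admissible s q l -> neg_relent q l <= opt.
Proof.
move=> [q01 qs ql]; apply: (@le_trans _ _ (\sum_i q i * ln (raised i))).
  apply: (@le_trans _ _ (\sum_i (q i * ln (raised i / 1) + (l i 0 * 1 / raised i - q i)))).
    apply: ler_sum => i _; apply: persp_tangent => //; last exact: raised_gt0.
      by case/andP: (q01 i).
    exact: ql.
  rewrite big_split /= sumrB qs.
  under [X in _ + (X - _)]eq_bigr do rewrite mulr1.
  by rewrite sum_div_raised subrr addr0; under eq_bigr do rewrite divr1.
rewrite -subr_le0 weighted_ln_raised //; apply: sumr_le0 => i _.
have /andP[_ q1] := q01 i; case: ltnP => h; last by rewrite ln_raised_low ?lc // subrr mulr0.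
by rewrite mulr_le0_ge0 ?subr_le0 ?subr_ge0 ?ln_raised.
Qed.

Let share (i : 'I_d) := l i 0 / raised i.

(** These weights [l_i / max (l_i) c = min 1 (l_i / c)] are the optimal ones, because at
    them the tangent inequality used for the upper bound is an equality. *)
Lemma share_admissible : admissible s share l.
Proof.
split=> [i||i]; last 1 first.
- by rewrite /share pmulr_lgt0 // invr_gt0 raised_gt0.
- by rewrite /share divr_ge0 ?l0 ?(ltW (raised_gt0 i)) //= ler_pdivrMr ?raised_gt0 // mul1r le_max lexx.
exact: sum_div_raised.
Qed.

Lemma share_nonincreasing (i j : 'I_d) : (i <= j)%N -> share j <= share i.
Proof.
move=> /Kl lij; rewrite /share ler_pdivrMr ?raised_gt0 // mulrAC ler_pdivlMr ?raised_gt0 //.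
rewrite /raised; have [h|h] := leP (l i 0) c; have [h'|h'] := leP (l j 0) c.
- by rewrite ler_wpM2r // ltW.
- by lra.
- by rewrite mulrC ler_wpM2l.
by rewrite mulrC.
Qed.

Lemma neg_relent_share : neg_relent share l = opt.
Proof.
have [_ qs _] := share_admissible.
transitivity (\sum_i share i * ln (raised i)).
  apply: eq_bigr => i _; rewrite /persp /share.
  have [->|ln0] := eqVneq (l i 0) 0; first by rewrite !mul0r.
  by rewrite invf_div mulrCA divff ?mulr1.
apply/eqP; rewrite -subr_eq0 weighted_ln_raised //; apply/eqP; apply: big1 => i _.
have [h|h] := leP (l i 0) c; first by rewrite ln_raised_low // subrr mulr0.
have -> : (i < s)%N by rewrite ltnNge; apply/negP => /lc; rewrite leNgt h.
rewrite /share /raised max_l ?(ltW h) // divff ?subrr ?mul0r //.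
by rewrite gt_eqF // (lt_trans c0).
Qed.

(** Weak duality: linearize -log at [max (l_i) c].  The slopes [1 / max (l_i) c] are
    nondecreasing in [i], so summation by parts and majorization compare
    [\sum_i xi_i / max (l_i) c] with [\sum_i l_i / max (l_i) c = s]. *)
Lemma opt_le_objective (xi : 'cV[R]_d) :
  (forall i, 0 <= xi i 0) -> majorizes xi l -> Kod xi ->
  ((- opt)%:E <= \sum_(i < d | (i < s)%N) - lne (xi i 0)%:E)%E.
Proof.
move=> xi0 maj Kxi.
apply: (@le_trans _ _ (\sum_(i < d | (i < s)%N) (- ln (raised i) - (xi i 0 / raised i - 1))%:E)%E); last first.
  by apply: lee_sum => i _; apply: neg_lne_tangent; rewrite ?raised_gt0.
rewrite sumEFin lee_fin sumrB sumrN -/opt lerDl oppr_ge0 sumrB subr_le0.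
rewrite [leRHS]big_mkcond /= sum_indicator // mulr1 -sum_div_raised.
apply: (@le_trans _ _ (\sum_i xi i 0 / raised i)).
  rewrite [leRHS](bigID (fun i : 'I_d => (i < s)%N)) /= lerDl sumr_ge0 // => i _.
  by rewrite divr_ge0 // ltW ?raised_gt0.
(* The slopes are nondecreasing and at most 1 / c, so c^-1 minus them are weights. *)
have : 0 <= \sum_i (c^-1 - (raised i)^-1) * (xi i 0 - l i 0).
  apply: abel_sum_ge0 => [i j ij|i|j _].
  - rewrite lerD2l lerN2 lef_pV2 ?posrE ?raised_gt0 // /raised.
    by rewrite ge_max le_max (Kl ij) /= le_max lexx orbT.
  - by rewrite subr_ge0 lef_pV2 ?posrE ?raised_gt0 // le_max lexx orbT.
  by rewrite sumrB subr_ge0; apply: (@majorizes_sum _ _ j.+1).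
have -> : \sum_i (c^-1 - (raised i)^-1) * (xi i 0 - l i 0)
  = \sum_i l i 0 / raised i - \sum_i xi i 0 / raised i + c^-1 * (\sum_i xi i 0 - \sum_i l i 0).
  by rewrite -!sumrB mulr_sumr -big_split /=; apply: eq_bigr => i _; ring.
by case: maj => -> _; rewrite subrr mulr0 addr0 subr_ge0.
Qed.

Let primal : 'cV[R]_d := \col_i (if (i < s)%N then raised i else 0).

Lemma Kod_primal : Kod primal.
Proof.
move=> i j ij; rewrite !mxE; case: ifP => js; last by case: ifP; rewrite // ltW ?raised_gt0.
by rewrite (leq_ltn_trans ij js) /raised ge_max !le_max (Kl ij) /= lexx orbT.
Qed.

(** Raising the first [s] entries to the level [c] and emptying the others moves mass
    to the front and, by the choice of [c], preserves the total. *)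
Lemma majorizes_primal : majorizes primal l.
Proof.
have xE i : primal i 0 - l i 0 = (if (i < s)%N then c else 0) - Num.min (l i 0) c.
  rewrite mxE /raised; case: ltnP => [_|/lc h]; last by rewrite min_l.
  by have [h|h] := leP (l i 0) c; lra.
have tot : \sum_i primal i 0 = \sum_i l i 0.
  apply/eqP; rewrite -subr_eq0 -sumrB; under eq_bigr do rewrite xE.
  by rewrite sumrB cE sum_indicator // subrr.
split => // j _; rewrite !sum_largest_Kod //; last exact: Kod_primal.
have [js|sj] := leqP j s.
  apply: ler_sum => i ij; rewrite mxE (leq_trans ij js) /raised.
  by rewrite le_max lexx.
have -> : \sum_(i < d | (i < j)%N) primal i 0 = \sum_i primal i 0.
  rewrite [RHS](bigID (fun i : 'I_d => (i < j)%N)) /= [X in _ + X]big1 ?addr0 //.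
  move=> i; rewrite -leqNgt mxE => ji.
  by rewrite ltnNge (leq_trans (ltnW sj) ji).
rewrite tot [leRHS](bigID (fun i : 'I_d => (i < j)%N)) /= lerDl sumr_ge0 //.
Qed.

Lemma gs_opt : gs s l = (- opt)%:E.
Proof.
apply/le_anti/andP; split; last first.
  by apply: le_ereal_inf_tmp => _ [x [x0 maj Kx] <-]; exact: opt_le_objective.
apply: ereal_inf_lbound; exists primal.
  split; [|exact: majorizes_primal|exact: Kod_primal].
  by move=> i; rewrite mxE; case: ifP => // _; rewrite ltW ?raised_gt0.
rewrite /opt -sumrN -sumEFin; apply: eq_bigr => i si.
by rewrite mxE si lne_EFin ?raised_gt0.
Qed.

(** Strong duality: the bounds on the two sides meet at [opt], which is reached by the
    raised vector in the minimum and by the shares in the maximum. *)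
Lemma gs_level_dual :
  (exists q, [/\ admissible s q l, forall i j : 'I_d, (i <= j)%N -> q j <= q i
             & gs s l = (- neg_relent q l)%:E]) /\
  (forall q, admissible s q l -> (gs s l <= (- neg_relent q l)%:E)%E).
Proof.
split; first by exists share; split; [exact: share_admissible|exact: share_nonincreasing|rewrite neg_relent_share gs_opt].
by move=> q' /neg_relent_le_opt; rewrite gs_opt lee_fin lerN2.
Qed.

End WaterLevel.

(** Weights at most 1 that add up to [s] have at least [s] indices in their support,
    and the support is an initial segment because [l] is sorted. *)
Lemma admissible_top (R : realType) (d s : nat) (q : 'I_d -> R) (l : 'cV[R]_d) :
  Kod l -> admissible s q l -> forall i : 'I_d, (i < s)%N -> 0 < l i 0.
Proof.
move=> Kl [q01 qs ql] i si; rewrite ltNge; apply/negP => li.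
have : \sum_i q i <= \sum_(j < d) (if (j < i)%N then 1 else 0).
  apply: ler_sum => j _; case: ltnP => ij; first by case/andP: (q01 j).
  rewrite leNgt; apply/negP => /ql; rewrite ltNge (le_trans _ li) //.
  exact: Kl.
rewrite qs sum_indicator; last exact: ltnW.
by rewrite mulr1 ler_nat leqNgt si.
Qed.

Lemma gs_le_neg_relent (R : realType) (d s : nat) (q : 'I_d -> R) (l : 'cV[R]_d) :
  (0 < s <= d)%N -> Kod l -> (forall i, 0 <= l i 0) -> admissible s q l ->
  (gs s l <= (- neg_relent q l)%:E)%E.
Proof.
move=> sd Kl l0 qa.
have [c [c0 cE lc]] := level_exists sd Kl l0 (admissible_top Kl qa).
by case/andP: sd => _ sd; apply: (gs_level_dual sd Kl l0 c0 cE lc).2.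
Qed.

(** A feasible point with finite objective has positive first [s] entries, and
    majorization makes every tail sum of [l] at least that of the feasible point. *)
Lemma gs_fin (R : realType) (d s : nat) (l : 'cV[R]_d) :
  (0 < s <= d)%N -> Kod l -> (gs s l < +oo)%E ->
  (forall i, 0 <= l i 0) /\ (forall i : 'I_d, (i < s)%N -> 0 < l i 0).
Proof.
move=> /andP[s0 sd] Kl /ereal_inf_lt[_ [xi [xi0 maj Kxi] <-]] fin.
have xip (i : 'I_d) : (i < s)%N -> 0 < xi i 0.
  move=> si; rewrite lt_def xi0 andbT; apply: contraTneq fin => xz.
  rewrite -leNgt leye_eq; apply/eqP/esum_eqyP.
    by move=> k _; rewrite /lne; case: ifP.
  by exists i; split; rewrite ?mem_index_enum // xz le0_lneNy.
have tailE (k : nat) (x : 'cV[R]_d) : \sum_(i < d | (k <= i)%N) x i 0 =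
   \sum_i x i 0 - \sum_(i < d | (i < k)%N) x i 0.
  rewrite (bigID (fun i : 'I_d => (i < k)%N) xpredT) /= addrC addrK.
  by apply: eq_bigl => i; rewrite -leqNgt.
have tail (k : nat) : \sum_(i < d | (k <= i)%N) xi i 0 <= \sum_(i < d | (k <= i)%N) l i 0.
  by rewrite !tailE; case: (maj) => -> _; rewrite lerD2l lerN2 majorizes_sum.
have l0 i : 0 <= l i 0.
  have d0 : (d.-1 < d)%N by rewrite prednK // (leq_ltn_trans _ (ltn_ord i)).
  apply: le_trans (Kl i (Ordinal d0) _); last by rewrite /= -ltnS prednK // (leq_ltn_trans _ d0).
  have one (x : 'cV[R]_d) : \sum_(i < d | (d.-1 <= i)%N) x i 0 = x (Ordinal d0) 0.
    rewrite (big_pred1 (Ordinal d0)) // => k; apply/idP/eqP => [dk|-> //].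
    apply/val_inj/eqP; rewrite /= eqn_leq dk andbT -ltnS prednK ?ltn_ord //.
    exact: leq_ltn_trans d0.
  by have := tail d.-1; rewrite !one; apply: le_trans.
split=> // i si; rewrite lt_def l0 andbT; apply/eqP => li.
have := tail i; rewrite [leRHS]big1 ?leNgt; last first.
  by move=> k ik; apply/le_anti; rewrite l0 -li Kl.
rewrite (bigD1 i) //= ltr_wpDr ?xip //.
by apply: sumr_ge0.
Qed.

Lemma gs_dual (R : realType) (d s : nat) (l : 'cV[R]_d) :
  (0 < s <= d)%N -> Kod l -> (gs s l < +oo)%E ->
  (forall i, 0 <= l i 0) /\
  exists q, [/\ admissible s q l, forall i j : 'I_d, (i <= j)%N -> q j <= q i
             & gs s l = (- neg_relent q l)%:E].
Proof.
move=> sd Kl /(gs_fin sd Kl)[l0 lp]; split=> //.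
have [c [c0 cE lc]] := level_exists sd Kl l0 lp.
by case/andP: sd => _ sd; apply: (gs_level_dual sd Kl l0 c0 cE lc).1.
Qed.

(** * Unitary diagonalization and pinching *)

Definition normsq (R : realType) (z : R[i]) : R := complex.Re z ^+ 2 + complex.Im z ^+ 2.

Lemma normsqE (R : realType) (z : R[i]) : real_complex R (normsq z) = z * z^*.
Proof. by rewrite /normsq add_Re2_Im2 sqr_normc. Qed.

Lemma normsq_ge0 (R : realType) (z : R[i]) : 0 <= normsq z.
Proof. by rewrite addr_ge0 ?sqr_ge0. Qed.

Definition toC (R : realType) m n (X : 'M[R]_(m, n)) : 'M[R[i]]_(m, n) :=
  map_mx (real_complex R) X.

Lemma spectral_char_poly (R : realType) (d : nat) (P : 'M[R[i]]_d) (D : 'rV[R[i]]_d) :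
  P \in unitmx -> char_poly (invmx P *m diag_mx D *m P) = \prod_i ('X - (D 0 i)%:P).
Proof.
move=> Pu; have CE : char_poly_mx (invmx P *m diag_mx D *m P) = map_mx polyC (invmx P) *m
      char_poly_mx (diag_mx D) *m map_mx polyC P.
  rewrite /char_poly_mx mulmxBr mulmxBl -!map_mxM; congr (_ - _).
  by rewrite scalar_mxC -mulmxA -map_mxM mulVmx// map_mx1 mulmx1.
rewrite /char_poly CE !det_mulmx mulrC mulrA -det_mulmx -map_mxM.
rewrite mulmxV// map_mx1 det1 mul1r -/(char_poly _) char_poly_trig ?diag_mx_is_trig//.
by apply: eq_bigr => i _; rewrite mxE eqxx mulr1n.
Qed.

(** The two factorizations of the characteristic polynomial agree up to a
    permutation, which is absorbed into the unitary matrix. *)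
Lemma spectral_eigvals (R : realType) (d : nat) (X : 'M[R]_d) : X^T = X ->
  exists2 U : 'M[R[i]]_d, U \is unitarymx &
    U *m toC X *m U^t* = diag_mx (toC (eigvals X)^T).
Proof.
move=> XT; have [_ cp] := eigvalsP XT.
have Yh : toC X \is hermsymmx.
  apply: realsym_hermsym.
    apply/is_hermitianmxP; rewrite expr0 scale1r.
    by apply/matrixP => i j; rewrite !mxE -[in LHS]XT mxE.
  by apply/mxOverP => i j; rewrite mxE; rewrite complex_real.
have /orthomx_spectralP Ye := hermitian_normalmx Yh.
set D := spectral_diag _ in Ye; set P := spectralmx _ in Ye.
have Pu : P \is unitarymx by exact: spectral_unitarymx.
have [p pE] : exists p : 'S_d, forall i, real_complex R (eigvals X i 0) = D 0 (p i).
  have : perm_eq [tuple real_complex R (eigvals X i 0) | i < d] [tuple D 0 i | i < d].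
    apply: prod_XsubC_eq; rewrite !big_tuple; under eq_bigr do rewrite tnth_mktuple.
    under [RHS]eq_bigr do rewrite tnth_mktuple.
    rewrite -(spectral_char_poly D (unitarymx_unit Pu)) -Ye -map_char_poly cp rmorph_prod /=.
    by apply: eq_bigr => i _; rewrite rmorphB /= map_polyX map_polyC.
  move=> /tuple_permP[p pE]; exists p => i.
  have /(congr1 (fun t : d.-tuple _ => tnth t i)) := val_inj pE.
  by rewrite !tnth_mktuple.
exists (row_perm p P).
  apply/unitarymxP; rewrite row_permE trmx_mul map_mxM mulmxA -[X in X *m _]mulmxA.
  rewrite (unitarymxP Pu) mulmx1 tr_perm_mx map_perm_mx -perm_mxM.
  by rewrite mulgV perm_mx1.
rewrite Ye invmx_unitary // row_permE trmx_mul map_mxM !mulmxA.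
rewrite !(mulmxtVK _ Pu) tr_perm_mx map_perm_mx.
rewrite -row_permE -col_permE.
by apply/matrixP => i j; rewrite !mxE pE (inj_eq perm_inj).
Qed.

Lemma diag_conj (R : realType) m n (M : 'M[R[i]]_(m, n)) (v : 'cV[R]_n) (j : 'I_m) :
  (M *m diag_mx (toC v^T) *m M^t*) j j
  = real_complex R (\sum_i normsq (M j i) * v i 0).
Proof.
rewrite mul_mx_diag mxE rmorph_sum; apply: eq_bigr => i _.
by rewrite !mxE rmorphM /= normsqE mulrAC.
Qed.

Lemma unitary_row_normsq (R : realType) m n (M : 'M[R[i]]_(m, n)) j :
  M \is unitarymx -> \sum_i normsq (M j i) = 1.
Proof.
move=> /unitarymxP /matrixP/(_ j j); rewrite !mxE eqxx => E.
apply: complexI; rewrite rmorph_sum rmorph1 -[RHS]E; apply: eq_bigr => i _.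
by rewrite /= normsqE !mxE.
Qed.

Lemma unitary_col_normsq (R : realType) n (M : 'M[R[i]]_n) i :
  M \is unitarymx -> \sum_j normsq (M j i) = 1.
Proof.
rewrite -trmx_unitary => /(unitary_row_normsq i) <-; apply: eq_bigr => j _.
by rewrite mxE.
Qed.

(** Schur: in any orthonormal basis the diagonal of a symmetric matrix is the image of
    its eigenvalues under the doubly stochastic matrix of squared moduli of the
    change of basis. *)
Lemma pinching (R : realType) (d : nat) (U : 'M[R[i]]_d) (X : 'M[R]_d) :
  U \is unitarymx -> X^T = X ->
  exists P : 'I_d -> 'I_d -> R, [/\ forall j i, 0 <= P j i,
    forall j, \sum_i P j i = 1, forall i, \sum_j P j i = 1 &
    forall j, (U *m toC X *m U^t*) j j
      = real_complex R (\sum_i P j i * eigvals X i 0)].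
Proof.
move=> Uu /spectral_eigvals[W Wu WX].
have Mu : U *m W^t* \is unitarymx by rewrite mul_unitarymx ?trmxC_unitary.
exists (fun j i => normsq ((U *m W^t*) j i)); split=> [j i|j|i|j].
- exact: normsq_ge0.
- exact: unitary_row_normsq.
- exact: unitary_col_normsq.
rewrite -diag_conj -WX trmx_mul map_mxM -map_trmx trmxCK !mulmxA.
by rewrite !mulmxKtV.
Qed.

(** * Convexity over symmetric matrices *)

(** Averaging the weights by the same doubly stochastic matrices as the eigenvalues
    keeps them in the hypersimplex, and the log-sum inequality over the disjoint
    union of the two index sets bounds the result. *)
Lemma neg_relent_mix (R : realType) (d s : nat) (l l1 l2 : 'cV[R]_d)
    (q1 q2 : 'I_d -> R) (P1 P2 : 'I_d -> 'I_d -> R) (a b : R) :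
  0 <= a -> 0 <= b -> a + b = 1 ->
  (forall j i, 0 <= P1 j i) -> (forall j i, 0 <= P2 j i) ->
  (forall j, \sum_i P1 j i = 1) -> (forall j, \sum_i P2 j i = 1) ->
  (forall i, \sum_j P1 j i = 1) -> (forall i, \sum_j P2 j i = 1) ->
  (forall i, 0 <= l1 i 0) -> (forall i, 0 <= l2 i 0) ->
  (forall j, l j 0 = a * (\sum_i P1 j i * l1 i 0) + b * (\sum_i P2 j i * l2 i 0)) ->
  admissible s q1 l1 -> admissible s q2 l2 ->
  exists2 q, admissible s q l & a * neg_relent q1 l1 + b * neg_relent q2 l2 <= neg_relent q l.
Proof.
move=> a0 b0 ab P10 P20 r1 r2 c1 c2 l10 l20 lE [q101 qs1 ql1] [q201 qs2 ql2].
(* One log-sum inequality over both spectra at once. *)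
pose w j (k : 'I_d + 'I_d) := match k with inl i => a * P1 j i | inr i => b * P2 j i end.
pose A k := match k with inl i => q1 i | inr i => q2 i end.
pose B k := match k with inl i => l1 i 0 | inr i => l2 i 0 end.
have w0 j k : 0 <= w j k by case: k => i /=; rewrite mulr_ge0.
have A01 k : 0 <= A k <= 1 by case: k => i /=.
have A0 k : 0 <= A k by case/andP: (A01 k).
have B0 k : 0 <= B k by case: k => i /=.
have AB k : 0 < A k -> 0 < B k by case: k => i /=; auto.
have lw j : l j 0 = \sum_k w j k * B k.
  rewrite lE big_sumType /= !mulr_sumr.
  by congr (_ + _); apply: eq_bigr => i _; rewrite mulrA.
have wr j : \sum_k w j k = 1 by rewrite big_sumType /= -!mulr_sumr r1 r2 !mulr1.
have wc f : \sum_j \sum_k w j k * f k = a * (\sum_i f (inl i)) + b * (\sum_i f (inr i)).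
  rewrite exchange_big big_sumType /= !mulr_sumr; congr (_ + _); apply: eq_bigr => i _.
    by rewrite -mulr_suml -mulr_sumr c1 mulr1.
  by rewrite -mulr_suml -mulr_sumr c2 mulr1.
pose q j := \sum_k w j k * A k.
exists q; last first.
  rewrite /neg_relent -(wc (fun k => persp (A k) (B k))); apply: ler_sum => j _.
  by rewrite lw; apply: log_sum => // k _; exact: AB.
split=> [j||j].
- apply/andP; split; first by apply: sumr_ge0 => k _; rewrite mulr_ge0.
  rewrite -(wr j); apply: ler_sum => k _; rewrite -[leRHS]mulr1 ler_wpM2l //.
  by case/andP: (A01 k).
- by rewrite wc /= qs1 qs2 -mulrDl ab mul1r.
rewrite lw => qj; rewrite lt_def sumr_ge0 ?andbT; last by move=> k _; rewrite mulr_ge0.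
apply: contraTneq qj => S0; rewrite -leNgt /q big1 // => k _.
have /eqP : w j k * B k = 0 by rewrite (psumr_eq0P _ S0) // => k' _; rewrite mulr_ge0.
rewrite mulf_eq0 => /orP[/eqP ->|/eqP Bk]; first by rewrite mul0r.
have -> : A k = 0; last by rewrite mulr0.
by apply/eqP; rewrite eq_le A0 andbT leNgt; apply/negP => /AB; rewrite Bk ltxx.
Qed.

(** In an eigenbasis of [a X1 + b X2] its eigenvalues are the same combination of the
    diagonals of [X1] and [X2], hence of doubly stochastic averages of their
    eigenvalues; optimal weights for [X1] and [X2] then combine into weights for it. *)
Lemma Gs_convex (R : realType) (d s : nat) (X1 X2 : 'M[R]_d) (a b r1 r2 : R) :
  (0 < s <= d)%N -> X1^T = X1 -> X2^T = X2 -> 0 <= a -> 0 <= b -> a + b = 1 ->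
  (Gs s X1 <= r1%:E)%E -> (Gs s X2 <= r2%:E)%E ->
  (Gs s (a *: X1 + b *: X2) <= (a * r1 + b * r2)%:E)%E.
Proof.
move=> sd X1T X2T a0 b0 ab g1 g2; set X := _ + _.
have XT : X^T = X by rewrite /X linearD !linearZ /= X1T X2T.
have [K1 _] := eigvalsP X1T; have [K2 _] := eigvalsP X2T; have [K _] := eigvalsP XT.
have [l10 [q1 [qa1 _ E1]]] := gs_dual sd K1 (le_lt_trans g1 (ltry _)).
have [l20 [q2 [qa2 _ E2]]] := gs_dual sd K2 (le_lt_trans g2 (ltry _)).
have [U Uu UE] := spectral_eigvals XT.
have [P1 [P10 P1r P1c D1]] := pinching Uu X1T.
have [P2 [P20 P2r P2c D2]] := pinching Uu X2T.
have lE j : eigvals X j 0 = a * (\sum_i P1 j i * eigvals X1 i 0)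
    + b * (\sum_i P2 j i * eigvals X2 i 0).
  apply: complexI; rewrite rmorphD !rmorphM /= -[X in _ * X + _]D1 -[X in _ + _ * X]D2.
  have <- : (U *m toC X *m U^t*) j j = real_complex R (eigvals X j 0).
    by rewrite UE !mxE eqxx mulr1n.
  have -> : toC X = real_complex R a *: toC X1 + real_complex R b *: toC X2.
    by rewrite /toC /X map_mxD !map_mxZ.
  rewrite mulmxDr mulmxDl -!scalemxAr -!scalemxAl mxE.
  by congr (_ + _); rewrite mxE.
have [q qa qE] := neg_relent_mix a0 b0 ab P10 P20 P1r P2r P1c P2c l10 l20 lE qa1 qa2.
have l0 j : 0 <= eigvals X j 0.
  by rewrite lE addr_ge0 ?mulr_ge0 ?sumr_ge0 // => i _; rewrite mulr_ge0.
apply: le_trans (gs_le_neg_relent sd K l0 qa) _; rewrite lee_fin.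
rewrite /Gs E1 lee_fin in g1; rewrite /Gs E2 lee_fin in g2.
apply: le_trans (lerD (ler_wpM2l a0 g1) (ler_wpM2l b0 g2)).
by rewrite !mulrN -opprD lerN2.
Qed.

(** * Cauchy-Binet and compound determinants *)

Lemma det_mulmx_ffun (T : comNzRingType) j n (A : 'M[T]_(j, n)) (B : 'M[T]_(n, j)) :
  \det (A *m B) = \sum_(f : {ffun 'I_j -> 'I_n}) (\prod_i A i (f i)) * \det (rowsub f B).
Proof.
under eq_bigr do rewrite mulr_sumr.
rewrite exchange_big; apply: eq_bigr => /= p _.
under eq_bigr do rewrite mxE.
rewrite bigA_distr_bigA mulr_sumr; apply: eq_bigr => /= f _.
rewrite big_split mulrCA; congr (_ * (_ * _)).
by apply: eq_bigr => i _; rewrite mxE.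
Qed.

(** Summing over all maps [f], rather than over increasing ones, counts every
    [j]-subset [j!] times (and non-injective maps contribute 0); symmetrizing the
    multilinear expansion over permutations produces the second minor. *)
Lemma cauchy_binet (T : comNzRingType) j n (A : 'M[T]_(j, n)) (B : 'M[T]_(n, j)) :
  \sum_(f : {ffun 'I_j -> 'I_n}) \det (colsub f A) * \det (rowsub f B)
  = \det (A *m B) *+ j`!.
Proof.
under eq_bigr do rewrite mulr_suml.
rewrite exchange_big /= -(card_Sn j) -sumr_const; apply: eq_big => // s _.
rewrite det_mulmx_ffun.
pose h (g : {ffun 'I_j -> 'I_n}) := [ffun i => g ((s^-1)%g i)].
(* Precomposing f with s^-1 moves the permutation onto the rows of B. *)
rewrite (reindex h) /=; last first.
  exists (fun g : {ffun 'I_j -> 'I_n} => [ffun i => g (s i)]) => g _;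
    by apply/ffunP => i; rewrite !ffunE ?permK ?permKV.
apply: eq_bigr => g _.
have -> : rowsub (h g) B = row_perm s^-1 (rowsub g B).
  by apply/matrixP => i k; rewrite !mxE ffunE.
rewrite row_permE det_mulmx det_perm odd_permV mulrACA -signr_addb addbb mul1r.
congr (_ * _); by apply: eq_bigr => i _; rewrite mxE ffunE permK.
Qed.

Lemma det_colsub_noninj (T : comNzRingType) j n (A : 'M[T]_(j, n)) (f : 'I_j -> 'I_n) :
  ~ injective f -> \det (colsub f A) = 0.
Proof.
move=> /injectiveP /injectivePn[i [k ik fik]].
rewrite -det_tr; apply: (determinant_alternate ik) => m.
by rewrite !mxE fik.
Qed.

(** The determinant of the weighted Gram matrix of the rows of [M], written by
    Cauchy-Binet as a polynomial in the weights [v]: its coefficients are visibly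
    nonnegative, and this form makes it log-convex in [ln v]. *)
Definition gram_det (R : realType) j n (M : 'M[R[i]]_(j, n)) (v : 'I_n -> R) : R :=
  \sum_(f : {ffun 'I_j -> 'I_n}) normsq (\det (colsub f M)) / j`!%:R * \prod_i v (f i).

Lemma gram_detE (R : realType) j n (M : 'M[R[i]]_(j, n)) (v : 'cV[R]_n) :
  \det (M *m diag_mx (toC v^T) *m M^t*) = real_complex R (gram_det M (fun i => v i 0)).
Proof.
have jn0 : (j`!%:R : R[i]) != 0 by rewrite pnatr_eq0 -lt0n fact_gt0.
apply: (mulIf jn0); rewrite [LHS]mulr_natr -mulmxA -cauchy_binet /gram_det.
rewrite rmorph_sum mulr_suml; apply: eq_bigr => f _ /=.
have -> : rowsub f (diag_mx (toC v^T) *m M^t*)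
    = diag_mx (\row_i real_complex R (v (f i) 0)) *m (colsub f M)^t*.
  by apply/matrixP => i k; rewrite !mul_diag_mx !mxE.
rewrite det_mulmx det_diag det_map_mx det_tr !rmorphM /= normsqE fmorphV rmorph_nat.
rewrite rmorph_prod.
under eq_bigr do rewrite mxE.
field.
exact: jn0.
Qed.

(** With [m] the [j]-th largest entry, the indices that the image of [f] has beyond the
    first [j] carry entries at most [m], and are as many as the indices it misses
    among the first [j], which carry entries at least [m]. *)
Lemma prod_inj_le (R : realType) j n (v : 'cV[R]_n) (f : 'I_j -> 'I_n) :
  Kod v -> (forall i, 0 <= v i 0) -> injective f ->
  \prod_i v (f i) 0 <= \prod_(i < n | (i < j)%N) v i 0.
Proof.
move=> Kv v0 fi; have [j0|jp] := posnP j.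
  by subst j; rewrite big_ord0 big_pred0.
have jn : (j <= n)%N by have := leq_card f fi; rewrite !card_ord.
pose S := (f @: [set: 'I_j])%SET; pose T := [set i : 'I_n | (i < j)%N]%SET.
have cS : #|S| = j by rewrite card_imset // cardsT card_ord.
have cT : #|T| = j.
  rewrite -sum1_card (eq_bigl (fun i : 'I_n => (i < j)%N)) => [|i]; last by rewrite inE.
  by rewrite -(big_ord_widen n (fun=> 1%N)) // sum1_card card_ord.
have -> : \prod_i v (f i) 0 = \prod_(k in S) v k 0.
  by rewrite big_imset //; [apply: eq_bigl => i; rewrite inE|move=> i k _ _; exact: fi].
have -> : \prod_(i < n | (i < j)%N) v i 0 = \prod_(k in T) v k 0.
  by apply: eq_bigl => i; rewrite inE.
have jn' : (j.-1 < n)%N by rewrite prednK.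
pose m := v (Ordinal jn') 0.
rewrite (big_setID T) [leRHS](big_setID S) /= finset.setIC.
rewrite ler_wpM2l ?prodr_ge0 //; apply: (@le_trans _ _ (m ^+ #|S :\: T|)).
  rewrite -prodr_const; apply: ler_prod => i; rewrite !inE v0 -leqNgt => /andP[ji _] /=.
  by apply: Kv => /=; apply: leq_trans (leq_pred _) ji.
have -> : #|S :\: T| = #|T :\: S| by rewrite !cardsD cS cT finset.setIC.
rewrite -prodr_const; apply: ler_prod => i; rewrite !inE v0 => /andP[_ ij] /=.
by apply: Kv => /=; rewrite -ltnS prednK.
Qed.

(** The coefficients add up to the Gram determinant of [M], which is 1, so [gram_det] is an
    average of the products [\prod_i v (f i)]. *)
Lemma gram_det_le (R : realType) j n (M : 'M[R[i]]_(j, n)) (v : 'cV[R]_n) :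
  M \is unitarymx -> Kod v -> (forall i, 0 <= v i 0) ->
  gram_det M (fun i => v i 0) <= \prod_(i < n | (i < j)%N) v i 0.
Proof.
move=> /unitarymxP Mu Kv v0; set p := \prod_(i < n | _) _.
have p0 : 0 <= p by apply: prodr_ge0.
have g1 : gram_det M (fun=> 1) = 1.
  apply: complexI; have := gram_detE M (const_mx 1).
  rewrite [X in gram_det M X](_ : _ = fun=> 1); last by apply/funext => i; rewrite mxE.
  move=> <-; rewrite /toC trmx_const map_const_mx diag_const_mx rmorph1 mulmx1 Mu.
  by rewrite det1.
rewrite -[leRHS]mul1r -g1 /gram_det mulr_suml; apply: ler_sum => f _.
have [fi|/det_colsub_noninj ->] := pselect (injective f); last first.
  by rewrite /normsq /= !expr0n addr0 !mul0r.
rewrite [X in _ <= _ * X * _]big1 // mulr1 ler_wpM2l ?prod_inj_le //.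
by rewrite divr_ge0 ?normsq_ge0.
Qed.

(** Log-sum-exp is convex: this is the tangent inequality at [r], obtained from the
    log-sum inequality with the Gibbs weights [c_i exp (r_i) / S r]. *)
Lemma log_sum_exp_tangent (R : realType) (I : finType) (c r r1 : I -> R)
    (S := fun r => \sum_i c i * expR (r i)) :
  (forall i, 0 <= c i) -> 0 < S r ->
  0 < S r1 /\
  ln (S r) + \sum_i c i * expR (r i) / S r * (r1 i - r i) <= ln (S r1).
Proof.
move=> c0 Sp; pose p i := c i * expR (r i) / S r.
have p0 i : 0 <= p i by rewrite !mulr_ge0 ?expR_ge0 // invr_ge0 ltW.
have ce0 i : 0 <= c i * expR (r1 i) by rewrite mulr_ge0 ?expR_ge0.
have pc i : 0 < p i -> 0 < c i.
  by rewrite /p => h; rewrite lt_def c0 andbT; apply: contraTneq h => ->; rewrite !mul0r ltxx.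
have p1 : \sum_i p i = 1 by rewrite -mulr_suml divff ?gt_eqF.
have S1p : 0 < S r1.
  rewrite lt_def sumr_ge0 // andbT; apply: contraTneq Sp => S0.
  rewrite -leNgt /S big1 // => i _.
  have /eqP : c i * expR (r1 i) = 0 by rewrite (psumr_eq0P _ S0).
  by rewrite mulf_eq0 (gt_eqF (expR_gt0 _)) orbF => /eqP ->; rewrite mul0r.
split=> //.
have cep i : 0 < 1 :> R -> 0 < p i -> 0 < c i * expR (r1 i).
  by move=> _ /pc ci; rewrite mulr_gt0 ?expR_gt0.
have := @log_sum R I (fun=> 1) p _ (fun=> ler01) p0 ce0 cep.
under [X in persp X]eq_bigr do rewrite mul1r.
under [X in persp _ X]eq_bigr do rewrite mul1r.
rewrite p1 {2}/persp divr1 mul1r; apply: le_trans.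
rewrite -[ln (S r)]mul1r -{1}p1 mulr_suml -big_split /=.
apply: ler_sum => i _; rewrite mul1r /persp -/(p i) -mulrDr.
have [->|pn0] := eqVneq (p i) 0; first by rewrite !mul0r.
have pp : 0 < p i by rewrite lt_def pn0 p0.
have cp := pc i pp.
have -> : c i * expR (r1 i) / p i = S r * expR (r1 i - r i).
  by rewrite /p expRD expRN; field; rewrite !gt_eqF ?expR_gt0.
by rewrite lnM ?posrE ?expR_gt0 // expRK.
Qed.

Lemma gram_det_expR (R : realType) j n (M : 'M[R[i]]_(j, n)) (x rho : 'I_n -> R) :
  gram_det M (fun i => expR (rho i) * x i) =
  \sum_(f : {ffun 'I_j -> 'I_n}) (normsq (\det (colsub f M)) / j`!%:R * \prod_i x (f i))
     * expR (\sum_i rho (f i)).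
Proof.
apply: eq_bigr => f _; rewrite big_split /= expR_sum.
by rewrite -[RHS]mulrA; congr (_ * _); rewrite mulrC.
Qed.

(** Weights [exp (r_i) x_i] turn the monomials of [gram_det] into exponentials of
    linear forms in [r].  Positivity transfers between different [r] because it only
    depends on the coefficients. *)
Lemma gram_det_log_convex (R : realType) j n (M : 'M[R[i]]_(j, n)) (x r1 r2 : 'I_n -> R)
    (a b : R) (g := fun r => gram_det M (fun i => expR (r i) * x i))
    (r := fun i => a * r1 i + b * r2 i) :
  (forall i, 0 <= x i) -> 0 <= a -> 0 <= b -> a + b = 1 -> 0 < g r ->
  [/\ 0 < g r1, 0 < g r2 & ln (g r) <= a * ln (g r1) + b * ln (g r2)].
Proof.
move=> x0 a0 b0 ab; rewrite /g !gram_det_expR => gp.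
have c0 (f : {ffun 'I_j -> 'I_n}) : 0 <= normsq (\det (colsub f M)) / j`!%:R * \prod_i x (f i).
  by rewrite mulr_ge0 ?divr_ge0 ?normsq_ge0 ?prodr_ge0.
have [g1 t1] := log_sum_exp_tangent (fun f : {ffun 'I_j -> 'I_n} => \sum_i r1 (f i)) c0 gp.
have [g2 t2] := log_sum_exp_tangent (fun f : {ffun 'I_j -> 'I_n} => \sum_i r2 (f i)) c0 gp.
split=> //; apply: le_trans (lerD (ler_wpM2l a0 t1) (ler_wpM2l b0 t2)).
rewrite !mulrDr addrACA -mulrDl ab mul1r lerDl !mulr_sumr -big_split /=.
rewrite big1 // => f _.
have -> : \sum_i r (f i) = a * (\sum_i r1 (f i)) + b * (\sum_i r2 (f i)).
  by rewrite !mulr_sumr -big_split.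
have -> : b = 1 - a by rewrite -ab addrC addKr.
ring.
Qed.

(** * Log-convexity of leading eigenvalue products *)

Definition weighted_gram (R : realType) (d : nat) (V : 'M[R]_d) (y : 'cV[R]_d) : 'M[R]_d :=
  V *m Diag y *m V^T.

Lemma weighted_gram_sym (R : realType) (d : nat) (V : 'M[R]_d) (y : 'cV[R]_d) :
  (weighted_gram V y)^T = weighted_gram V y.
Proof. by rewrite /weighted_gram !trmx_mul trmxK tr_diag_mx mulmxA. Qed.

Lemma toC_weighted_gram (R : realType) (d : nat) (V : 'M[R]_d) (y : 'cV[R]_d) :
  toC (weighted_gram V y) = toC V *m diag_mx (toC y^T) *m (toC V)^t*.
Proof.
rewrite /toC /weighted_gram !map_mxM /Diag map_diag_mx; congr (_ *m _).
by apply/matrixP => i j; rewrite !mxE; exact/esym/conjc_real.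
Qed.

Lemma eigvals_weighted_gram_ge0 (R : realType) (d : nat) (V : 'M[R]_d) (y : 'cV[R]_d) :
  (forall i, 0 <= y i 0) -> forall i, 0 <= eigvals (weighted_gram V y) i 0.
Proof.
move=> y0 i; have [U Uu UE] := spectral_eigvals (weighted_gram_sym V y).
have := congr1 (fun Y : 'M[R[i]]_d => Y i i) UE.
rewrite toC_weighted_gram !mulmxA -[_ *m _ *m U^t* ]mulmxA -map_mxM -trmx_mul diag_conj.
rewrite !mxE eqxx mulr1n => /complexI <-.
by apply: sumr_ge0 => k _; rewrite mulr_ge0 ?normsq_ge0.
Qed.

Lemma ln_prod (R : realType) (I : Type) (r : seq I) (P : pred I) (F : I -> R) :
  (forall i, P i -> 0 < F i) ->
  ln (\prod_(i <- r | P i) F i) = \sum_(i <- r | P i) ln (F i).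
Proof.
move=> F0; suff : 0 < \prod_(i <- r | P i) F i /\
    ln (\prod_(i <- r | P i) F i) = \sum_(i <- r | P i) ln (F i) by case.
apply: (big_rec2 (fun p t => 0 < p /\ ln p = t)); first by rewrite ltr01 ln1.
move=> i p t Pi [p0 <-]; split; first by rewrite mulr_gt0 // F0.
by rewrite lnM ?posrE ?F0.
Qed.

Lemma top_eigvals_attained (R : realType) (d k : nat) (X : 'M[R]_d) :
  X^T = X -> (k <= d)%N -> exists2 M : 'M[R[i]]_(k, d), M \is unitarymx &
  \det (M *m toC X *m M^t*) = real_complex R (\prod_(i < d | (i < k)%N) eigvals X i 0).
Proof.
move=> XT kd; have [U Uu UE] := spectral_eigvals XT.
pose h := widen_ord kd; pose E : 'M[R[i]]_(k, d) := rowsub h 1%:M.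
have EU : rowsub h U = E *m U by rewrite /E mul_rowsub_mx mul1mx.
have Et : E^t* = colsub h 1%:M.
  by apply/matrixP => i j; rewrite !mxE rmorph_nat eq_sym.
exists (rowsub h U).
  apply/unitarymxP; rewrite EU trmx_mul map_mxM mulmxA mulmxtVK // Et.
  rewrite mulmx_colsub mulmx1; apply/matrixP => i j; rewrite !mxE.
  by rewrite -val_eqE.
rewrite EU trmx_mul map_mxM !mulmxA -[E *m U *m _]mulmxA -[E *m (U *m _) *m _]mulmxA UE Et.
rewrite mulmx_colsub mulmx1 mul_rowsub_mx mul1mx.
rewrite (_ : colsub _ _ = diag_mx (\row_i real_complex R (eigvals X (h i) 0))); last first.
  by apply/matrixP => i j; rewrite !mxE -val_eqE.
rewrite det_diag (big_ord_narrow kd) rmorph_prod.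
by apply: eq_bigr => i _; rewrite mxE.
Qed.

(** In an eigenbasis of [X], the compression of [X] to the rows of [M] is a Gram matrix
    weighted by the eigenvalues. *)
Lemma top_eigvals_max (R : realType) (d k : nat) (X : 'M[R]_d) (M : 'M[R[i]]_(k, d)) (g : R) :
  X^T = X -> (forall i, 0 <= eigvals X i 0) -> M \is unitarymx ->
  \det (M *m toC X *m M^t*) = real_complex R g ->
  g <= \prod_(i < d | (i < k)%N) eigvals X i 0.
Proof.
move=> XT l0 Mu; have [K _] := eigvalsP XT; have [U Uu UE] := spectral_eigvals XT.
have -> : M *m toC X *m M^t* = (M *m U^t*) *m diag_mx (toC (eigvals X)^T) *m (M *m U^t*)^t*.
  by rewrite -UE trmx_mul map_mxM -map_trmx trmxCK !mulmxA !mulmxKtV.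
rewrite gram_detE => /(@complexI R) <-; apply: gram_det_le; [|exact: K|exact: l0].
by rewrite mul_unitarymx ?trmxC_unitary.
Qed.

(** Choose the [k]-dimensional subspace that attains the eigenvalue product at the
    middle point; on this fixed subspace the compressed determinant is log-convex,
    and at the two end points it is bounded by the eigenvalue products there. *)
Lemma top_eigvals_log_convex (R : realType) (d k : nat) (V : 'M[R]_d)
    (x r1 r2 : 'cV[R]_d) (a b : R)
    (l := fun r : 'cV[R]_d => eigvals (weighted_gram V (\col_i (expR (r i 0) * x i 0)))) :
  (forall i, 0 <= x i 0) -> 0 <= a -> 0 <= b -> a + b = 1 -> (k <= d)%N ->
  (forall i : 'I_d, (i < k)%N -> 0 < l (a *: r1 + b *: r2) i 0) ->
  [/\ forall i : 'I_d, (i < k)%N -> 0 < l r1 i 0,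
      forall i : 'I_d, (i < k)%N -> 0 < l r2 i 0 &
      \sum_(i < d | (i < k)%N) ln (l (a *: r1 + b *: r2) i 0) <=
      a * (\sum_(i < d | (i < k)%N) ln (l r1 i 0))
        + b * (\sum_(i < d | (i < k)%N) ln (l r2 i 0))].
Proof.
move=> x0 a0 b0 ab kd lp.
pose X (r : 'cV[R]_d) := weighted_gram V (\col_i (expR (r i 0) * x i 0)).
have XT r : (X r)^T = X r by exact: weighted_gram_sym.
have l0 r i : 0 <= l r i 0.
  by apply: eigvals_weighted_gram_ge0 => k'; rewrite mxE mulr_ge0 ?expR_ge0.
have [M Mu ME] := top_eigvals_attained (XT (a *: r1 + b *: r2)) kd.
pose g (r : 'I_d -> R) := gram_det (M *m toC V) (fun i => expR (r i) * x i 0).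
have detE (r : 'cV[R]_d) : \det (M *m toC (X r) *m M^t*) = real_complex R (g (fun i => r i 0)).
  rewrite /X toC_weighted_gram !mulmxA -[_ *m _ *m M^t* ]mulmxA -map_mxM -trmx_mul gram_detE.
  by congr (real_complex R (gram_det _ _)); apply/funext => i; rewrite mxE.
have gE : g (fun i => a * r1 i 0 + b * r2 i 0)
    = \prod_(i < d | (i < k)%N) l (a *: r1 + b *: r2) i 0.
  apply: complexI; rewrite -ME detE; congr (real_complex R (g _)).
  by apply/funext => i; rewrite !mxE.
have gp : 0 < g (fun i => a * r1 i 0 + b * r2 i 0) by rewrite gE; apply: prodr_gt0.
have [g1 g2 gc] := @gram_det_log_convex R k d _ _ (r1^~ 0) (r2^~ 0) a b x0 a0 b0 ab gp.
have gle (r : 'cV[R]_d) : g (fun i => r i 0) <= \prod_(i < d | (i < k)%N) l r i 0.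
  exact: top_eigvals_max (XT r) (l0 r) Mu (detE r).
have pos (r : 'cV[R]_d) : 0 < g (fun i => r i 0) -> forall i : 'I_d, (i < k)%N -> 0 < l r i 0.
  move=> gr i ik; rewrite lt_def l0 andbT; apply: contraTneq (lt_le_trans gr (gle r)) => li.
  by rewrite (bigD1 i) //= li mul0r ltxx.
have lng (r : 'cV[R]_d) : 0 < g (fun i => r i 0) ->
    ln (g (fun i => r i 0)) <= \sum_(i < d | (i < k)%N) ln (l r i 0).
  move=> gr; rewrite -ln_prod; last exact: (pos r gr).
  rewrite ler_ln; [exact: gle|exact: gr|].
  by rewrite posrE; apply: prodr_gt0; exact: (pos r gr).
split; [exact: (pos r1 g1)|exact: (pos r2 g2)|].
have lnE := ln_prod (index_enum 'I_d) lp; rewrite -gE in lnE.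
rewrite -[leLHS]lnE; apply: (le_trans gc).
by apply: lerD; apply: ler_wpM2l => //; [exact: (lng r1 g1)|exact: (lng r2 g2)].
Qed.

Lemma neg_relent_split (R : realType) (d s : nat) (q : 'I_d -> R) (l : 'cV[R]_d) :
  admissible s q l ->
  neg_relent q l = \sum_i q i * ln (l i 0) - \sum_i q i * ln (q i).
Proof.
move=> [q01 _ ql]; rewrite -sumrB; apply: eq_bigr => i _; rewrite /persp.
have [->|qn0] := eqVneq (q i) 0; first by rewrite !mul0r subrr.
have qp : 0 < q i by rewrite lt_def qn0; case/andP: (q01 i).
by rewrite ln_div ?posrE ?ql // mulrBr.
Qed.

(** For fixed nonincreasing weights, [neg_relent] is a nonnegative combination of the
    partial sums of the logarithms of the eigenvalues, up to a constant. *)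
Lemma neg_relent_log_convex (R : realType) (d s : nat) (q : 'I_d -> R) (l l1 l2 : 'cV[R]_d)
    (a b : R) : a + b = 1 ->
  admissible s q l -> admissible s q l1 -> admissible s q l2 ->
  (forall i j : 'I_d, (i <= j)%N -> q j <= q i) ->
  (forall j : 'I_d, 0 < q j -> \sum_(i < d | (i < j.+1)%N) ln (l i 0) <=
     a * (\sum_(i < d | (i < j.+1)%N) ln (l1 i 0))
     + b * (\sum_(i < d | (i < j.+1)%N) ln (l2 i 0))) ->
  neg_relent q l <= a * neg_relent q l1 + b * neg_relent q l2.
Proof.
move=> ab qa qa1 qa2 qd cvx.
rewrite (neg_relent_split qa) (neg_relent_split qa1) (neg_relent_split qa2).
pose t i := a * ln (l1 i 0) + b * ln (l2 i 0) - ln (l i 0).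
have : 0 <= \sum_i q i * t i.
  apply: abel_sum_ge0 => // [i|j /cvx]; first by case: qa => q01 _ _; case/andP: (q01 i).
  by rewrite sumrB big_split /= -!mulr_sumr subr_ge0.
have -> : \sum_i q i * t i = a * (\sum_i q i * ln (l1 i 0))
    + b * (\sum_i q i * ln (l2 i 0)) - \sum_i q i * ln (l i 0).
  by rewrite !mulr_sumr -big_split -sumrB; apply: eq_bigr => i _; rewrite /t /=; ring.
have -> : b = 1 - a by rewrite -ab addrC addKr.
lra.
Qed.

(** If the middle value is +oo nothing is to be proved.  Otherwise its optimal weights
    are tested at the end points, where they stay admissible. *)
Lemma Gs_weighted_gram_log_concave (R : realType) (d s : nat) (V : 'M[R]_d)
    (x r1 r2 : 'cV[R]_d) (a b u1 u2 : R)
    (X := fun r : 'cV[R]_d => weighted_gram V (\col_i (expR (r i 0) * x i 0))) :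
  (0 < s <= d)%N -> (forall i, 0 <= x i 0) -> 0 <= a -> 0 <= b -> a + b = 1 ->
  (u1%:E <= Gs s (X r1))%E -> (u2%:E <= Gs s (X r2))%E ->
  ((a * u1 + b * u2)%:E <= Gs s (X (a *: r1 + b *: r2)%R))%E.
Proof.
move=> sd x0 a0 b0 ab g1 g2; set r : 'cV[R]_d := a *: r1 + b *: r2.
have XT r' : (X r')^T = X r' by exact: weighted_gram_sym.
have K r' : Kod (eigvals (X r')) by case: (eigvalsP (XT r')).
have l0 r' i : 0 <= eigvals (X r') i 0.
  by apply: eigvals_weighted_gram_ge0 => k; rewrite mxE mulr_ge0 ?expR_ge0.
have [fin|] := ltP (Gs s (X r)) +oo%E; last by rewrite leye_eq => /eqP ->; rewrite leey.
have [_ [q [qa qd E]]] := gs_dual sd (K r) fin.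
have [q01 qs ql] := qa.
have q0 i : 0 <= q i by case/andP: (q01 i).
have top j : 0 < q j -> forall i : 'I_d, (i < j.+1)%N -> 0 < eigvals (X r) i 0.
  by move=> /ql lj i ij; apply: lt_le_trans lj (K _ _ _ _).
have cvx (j : 'I_d) (qj : 0 < q j) := top_eigvals_log_convex x0 a0 b0 ab (ltn_ord j) (top j qj).
have qa1 : admissible s q (eigvals (X r1)).
  by split=> [||j /cvx[h _ _]]; [exact: q01|exact: qs|exact: (h j (ltnSn j))].
have qa2 : admissible s q (eigvals (X r2)).
  by split=> [||j /cvx[_ h _]]; [exact: q01|exact: qs|exact: (h j (ltnSn j))].
have h1 := le_trans g1 (gs_le_neg_relent sd (K r1) (l0 r1) qa1).
have h2 := le_trans g2 (gs_le_neg_relent sd (K r2) (l0 r2) qa2).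
rewrite lee_fin in h1; rewrite lee_fin in h2; rewrite /Gs E lee_fin.
apply: le_trans (lerD (ler_wpM2l a0 h1) (ler_wpM2l b0 h2)) _.
rewrite !mulrN -opprD lerN2; apply: (neg_relent_log_convex ab qa qa1 qa2 qd) => j.
by case/cvx.
Qed.

(** * Extended-real convexity *)

Lemma weighted_gram_linear (R : realType) (d : nat) (V : 'M[R]_d) (y1 y2 : 'cV[R]_d) (a b : R) :
  weighted_gram V (a *: y1 + b *: y2) = a *: weighted_gram V y1 + b *: weighted_gram V y2.
Proof.
by rewrite /weighted_gram /Diag !linearD !linearZ /= mulmxDl -!scalemxAl.
Qed.

Lemma f_Gamma_gE (R : realType) (d s : nat) (V : 'M[R]_d) (x rho : 'cV[R]_d) :
  f_Gamma_g s V x rho = (Gs s (weighted_gram V (\col_i (expR (rho i 0) * x i 0))%R)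
    + (\sum_i x i 0 * rho i 0)%:E)%E.
Proof.
have XE : V *m Diag (map_mx expR rho) *m Diag x *m V^T
    = weighted_gram V (\col_i (expR (rho i 0) * x i 0)).
  rewrite /weighted_gram -[X in X *m _]mulmxA /Diag mulmx_diag.
  by congr (_ *m diag_mx _ *m _); apply/rowP => i; rewrite !mxE.
by rewrite /f_Gamma_g XE.
Qed.

(** Since the added term is finite, it moves across the inequality of the epigraph. *)
Lemma convex_ereal_add_linear (R : realType) (E : lmodType R) (f g : E -> \bar R)
    (L : E -> R) :
  (forall x, f x = (g x + (L x)%:E)%E) ->
  (forall x1 x2 a b, L (a *: x1 + b *: x2) = a * L x1 + b * L x2) ->
  (forall x1 x2 (u1 u2 a b : R), 0 <= a -> 0 <= b -> a + b = 1 ->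
    (g x1 <= u1%:E)%E -> (g x2 <= u2%:E)%E ->
    (g (a *: x1 + b *: x2)%R <= (a * u1 + b * u2)%:E)%E) -> convex_ereal f.
Proof.
move=> fE Llin gcvx [x1 u1] [x2 u2] t; rewrite !inE /= !fE -!leeBrDr // -!EFinB.
move=> h1 h2; have tt : t%:num + (1 - t%:num) = 1 by rewrite addrC subrK.
have t0 : 0 <= t%:num by [].
have t1 : 0 <= 1 - t%:num by rewrite subr_ge0.
have := gcvx _ _ _ _ _ _ t0 t1 tt h1 h2.
by rewrite Llin; congr (_ <= _%:E)%E; rewrite /unstable.onem /GRing.scale /=; ring.
Qed.

Lemma concave_ereal_add_linear (R : realType) (E : lmodType R) (f g : E -> \bar R)
    (L : E -> R) :
  (forall x, f x = (g x + (L x)%:E)%E) ->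
  (forall x1 x2 a b, L (a *: x1 + b *: x2) = a * L x1 + b * L x2) ->
  (forall x1 x2 (u1 u2 a b : R), 0 <= a -> 0 <= b -> a + b = 1 ->
    (u1%:E <= g x1)%E -> (u2%:E <= g x2)%E ->
    ((a * u1 + b * u2)%:E <= g (a *: x1 + b *: x2)%R)%E) -> concave_ereal f.
Proof.
move=> fE Llin gcvx [x1 u1] [x2 u2] t; rewrite !inE /= !fE -!leeBlDr // -!EFinB.
move=> h1 h2; have tt : t%:num + (1 - t%:num) = 1 by rewrite addrC subrK.
have t0 : 0 <= t%:num by [].
have t1 : 0 <= 1 - t%:num by rewrite subr_ge0.
have := gcvx _ _ _ _ _ _ t0 t1 tt h1 h2.
by rewrite Llin; congr (_%:E <= _)%E; rewrite /unstable.onem /GRing.scale /=; ring.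
Qed.

Theorem proposition10 (R : realType) (d m s : nat)
    (A : 'M[R]_(m, d)) (b : 'cV[R]_m) (V : 'M[R]_d)
    (hs : (1 <= s <= d)%N) (hV : V^T \in unitmx) :
  (forall rho : 'cV[R]_d,
     convex_ereal (fun x : 'cV[R]_d => f_Gamma_g s V x rho)) /\
  (forall x : 'cV[R]_d, feasible s A b x ->
     concave_ereal (fun rho : 'cV[R]_d => f_Gamma_g s V x rho)).
Proof.
split=> [rho|x [x01 _ _]].
  apply: (convex_ereal_add_linear (fun x => f_Gamma_gE s V x rho))
    => [x1 x2 a c|x1 x2 u1 u2 a c a0 c0 ac h1 h2].
    by rewrite !mulr_sumr -big_split; apply: eq_bigr => i _; rewrite !mxE /=; ring.
  rewrite [X in weighted_gram V X](_ : _ = a *: (\col_i (expR (rho i 0) * x1 i 0))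
      + c *: (\col_i (expR (rho i 0) * x2 i 0))).
    rewrite weighted_gram_linear.
    exact: Gs_convex hs (weighted_gram_sym _ _) (weighted_gram_sym _ _) a0 c0 ac h1 h2.
  by apply/colP => i; rewrite !mxE; ring.
apply: (concave_ereal_add_linear (f_Gamma_gE s V x))
  => [r1 r2 a c|r1 r2 u1 u2 a c a0 c0 ac h1 h2].
  by rewrite !mulr_sumr -big_split; apply: eq_bigr => i _; rewrite !mxE /=; ring.
have x0 i : 0 <= x i 0 by case/andP: (x01 i).
exact: Gs_weighted_gram_log_concave hs x0 a0 c0 ac h1 h2.
Qed.
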